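(* Let $\beta,\rho,\gamma$ be positive real numbers, with $\beta>1$ so that the set $\mathcal{M}_\beta$ is defined, and let $\lambda\in(0,1)$. Let $(A,B)\in\mathcal{M}_\beta$ with $A\in\mathbb{R}^{n\times n}$, $B\in\mathbb{R}^{n\times m}$, and let $P\in\mathbb{R}^{n\times n}$ be a positive definite solution of the Riccati equation $$P=\min_{K}\left[I+K^\top K+(A+BK)^\top P(A+BK)\right].$$ Let $$x_{t+1}=Ax_t+Bu_t+w_t,\qquad u_t=K_tx_t+\epsilon_t,\qquad t\ge0,$$ with $x_t,w_t\in\mathbb{R}^n$, $u_t,\epsilon_t\in\mathbb{R}^m$, $K_t\in\mathbb{R}^{m\times n}$, and suppose that $\Sigma_t,\hat\Sigma_t$ are defined by $$\Sigma_t=\sum_{k=0}^{t-1}\lambda^{t-1-k}\begin{bmatrix}x_k\\ u_k\end{bmatrix}\begin{bmatrix}x_k\\ u_k\end{bmatrix}^\top+\lambda^t\Sigma_0,\qquad \hat\Sigma_t=\sum_{k=0}^{t-1}\lambda^{t-1-k}x_{k+1}\begin{bmatrix}x_k\\ u_k\end{bmatrix}^\top,$$ where $\Sigma_0\in\mathbb{R}^{(n+m)\times(n+m)}$ is symmetric positive definite, while $$\left\|\begin{bmatrix}A&B\end{bmatrix}-\hat\Sigma_t\Sigma_t^{-1}\right\|\le\rho\qquad\text{for } t\ge t_0.$$ For each $t$, let $Q_t$ be a solution of $$\Sigma_t\left(Q_t-I\right)\Sigma_t=\hat\Sigma_t^\top\min_{K}\left(\begin{bmatrix}I\\ K\end{bmatrix}^\top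 Q_t\begin{bmatrix}I\\ K\end{bmatrix}\right)\hat\Sigma_t$$ with $K_t$ being a minimizing argument. Define $$\alpha:=\beta^2+\frac{1}{1-\beta^2/\gamma^2}\left(1-\frac{\beta^2}{1-2\beta^2\rho(\rho+2)}\right).$$ If $\alpha>0$, then $$\sum_{t=t_0}^{T-1}\left(|x_t|^2+|K_tx_t|^2\right)\le\alpha^{-1}|x_{t_0}|_P^2+\frac{\gamma^2}{\alpha}\sum_{t=t_0}^{T-1}|B\epsilon_t+w_t|^2 ,$$ where $T>t_0$ is the final time of the sums.
   Context: For symmetric matrices, $\succeq$, $\preceq$, $\succ$ denote the positive semidefinite order; $\|\cdot\|$ is the spectral (operator) norm, $|\cdot|$ is the Euclidean norm, and $|x|_P^2:=x^\top Px$. Minima over $K\in\mathbb{R}^{m\times n}$ of symmetric-matrix-valued expressions are taken in the positive semidefinite order. For $Q=\begin{bmatrix}Q^{xx}&Q^{xu}\\ Q^{ux}&Q^{uu}\end{bmatrix}\succ0$ with $Q^{xx}\in\mathbb{R}^{n\times n}$ and $Q^{uu}\in\mathbb{R}^{m\times m}$, $$\min_K\begin{bmatrix}I\\ K\end{bmatrix}^\top Q\begin{bmatrix}I\\ K\end{bmatrix}=Q^{xx}-Q^{xu}(Q^{uu})^{-1}Q^{ux}.$$ For $\beta>1$, $\mathcal{M}_\beta$ is the set of all pairs $(A,B)\in\mathbb{R}^{n\times n}\times\mathbb{R}^{n\times m}$ such that the equation $$Q-I=\begin{bmatrix}A&B\end{bmatrix}^\top\min_{K}\left(\begin{bmatrix}I\\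 K\end{bmatrix}^\top Q\begin{bmatrix}I\\ K\end{bmatrix}\right)\begin{bmatrix}A&B\end{bmatrix}$$ has a solution $Q\in\mathbb{R}^{(n+m)\times(n+m)}$ with $I\preceq Q\preceq\beta^2I$.
   Formalization: The formal theorem additionally assumes that both denominators in α are positive, 1−β²/γ²>0 and 1−2β²ρ(ρ+2)>0 (the claim can fail otherwise, e.g. A=B=0, β=2, ρ=1, γ=4), and that every Q_t is positive definite, the setting in which the minimum over K is introduced. *)

(* Defs.v *)
From HB Require Import structures.
From mathcomp Require Export all_boot all_order all_algebra.
From mathcomp Require Export boolp classical_sets reals.

Set Implicit Arguments.
Unset Strict Implicit.
Unset Printing Implicit Defensive.

Import Order.TTheory GRing.Theory Num.Theory.
Local Open Scope classical_set_scope.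
Local Open Scope ring_scope.

Section MatrixOrder.
Context {R : realType}.

(* qform P v is |v|_P^2; it is a genuine squared norm only when P is positive
   definite. *)
Definition qform k (P : 'M[R]_k) (v : 'cV[R]_k) : R := (v^T *m P *m v) 0 0.

(* The norm that the library puts on matrices is the maximum of the entries,
   so the Euclidean and spectral norms are defined here. *)
Definition enorm k (v : 'cV[R]_k) : R := Num.sqrt ((v^T *m v) 0 0).

Definition spnorm k l (M : 'M[R]_(k, l)) : R :=
  sup [set enorm (M *m v) | v in [set v : 'cV[R]_l | enorm v <= 1]].

Definition psdmx k (X : 'M[R]_k) : Prop :=
  X^T = X /\ forall v : 'cV[R]_k, 0 <= qform X v.

Definition pdmx k (X : 'M[R]_k) : Prop :=
  X^T = X /\ forall v : 'cV[R]_k, v != 0 -> 0 < qform X v.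

Definition lemx k (X Y : 'M[R]_k) : Prop := psdmx (Y - X).

(* Minimality is with respect to a partial order: a minimizing argument must
   have a value below all the other values.  As lemx is antisymmetric, there is
   at most one S such that is_minmx F S. *)
Definition is_argminmx (I : Type) k (F : I -> 'M[R]_k) (K : I) : Prop :=
  forall K', lemx (F K) (F K').

Definition is_minmx (I : Type) k (F : I -> 'M[R]_k) (S : 'M[R]_k) : Prop :=
  exists2 K, is_argminmx F K & S = F K.

End MatrixOrder.

Section Control.
Context {R : realType} {n m : nat}.
Implicit Types (A : 'M[R]_n) (B : 'M[R]_(n, m)) (K : 'M[R]_(m, n)).

Definition gainform (Q : 'M[R]_(n + m)) K : 'M[R]_n :=
  (col_mx 1%:M K)^T *m Q *m col_mx 1%:M K.

Definition riccatiform A B (P : 'M[R]_n) K : 'M[R]_n :=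
  1%:M + K^T *m K + (A + B *m K)^T *m P *m (A + B *m K).

Definition calM (beta : R) : set ('M[R]_n * 'M[R]_(n, m)) :=
  [set AB | exists (Q : 'M[R]_(n + m)) (S : 'M[R]_n),
     [/\ is_minmx (gainform Q) S,
         Q - 1%:M = (row_mx AB.1 AB.2)^T *m S *m row_mx AB.1 AB.2,
         lemx 1%:M Q & lemx Q (beta ^+ 2)%:M]].

Definition data_riccati (Sigma : 'M[R]_(n + m)) (hSigma : 'M[R]_(n, n + m))
    (Q : 'M[R]_(n + m)) : Prop :=
  exists2 S, is_minmx (gainform Q) S &
    Sigma *m (Q - 1%:M) *m Sigma = hSigma^T *m S *m hSigma.

Section Correlations.
Variables (lambda : R) (x : nat -> 'cV[R]_n) (u : nat -> 'cV[R]_m).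

Definition Sigma_ (Sigma0 : 'M[R]_(n + m)) (t : nat) : 'M[R]_(n + m) :=
  \sum_(k < t) lambda ^+ (t - 1 - k) *:
     (col_mx (x k) (u k) *m (col_mx (x k) (u k))^T)
  + lambda ^+ t *: Sigma0.

Definition hSigma_ (t : nat) : 'M[R]_(n, n + m) :=
  \sum_(k < t) lambda ^+ (t - 1 - k) *:
     (x k.+1 *m (col_mx (x k) (u k))^T).

End Correlations.
End Control.

Definition alpha_ {R : realType} (beta rho gamma : R) : R :=
  beta ^+ 2 + 1 / (1 - beta ^+ 2 / gamma ^+ 2) *
    (1 - beta ^+ 2 / (1 - 2 * beta ^+ 2 * rho * (rho + 2))).

(* Main.v *)
Require Import Defs.
From mathcomp Require Import ring lra.
Import Order.TTheory GRing.Theory Num.Theory.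
Local Open Scope classical_set_scope.
Local Open Scope ring_scope.

(** Write [M = [A B]] and, at a fixed time [t >= t0], [N] for the least-squares
    model [hSigma_t Sigma_t^-1], so that [|(M - N) z| <= rho |z|].  Since
    [Sigma_t] is positive definite it can be cancelled from the data-driven
    equation, which then says that [V := min_K gainform Q_t] is the value
    function of the linear quadratic problem with dynamics [N] and stage cost
    [|x|^2 + |u|^2], with [K_t] its optimal gain.  In the same way membership of
    [(A, B)] in [calM beta] produces a value function for the dynamics [M] whose
    one-step cost is at most [beta^2 |z|^2]; a nonnegative value function
    is determined by its dynamics ([optimal_value_unique]), so this one is [P].

    The tool throughout is [riccati_comparison]: a nonnegative quadratic form
    which some policy makes decrease by at least [c] times the stage cost
    dominates [c] times the value function.  Put
    [kappa = beta^2 rho (rho + 2)].  By Young's inequality replacing [M z] by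
    [N z] costs at most [kappa |z|^2], measured in [P].  Comparing along the
    true optimal policy run in the model gives [(1 - kappa) V <= P]; this bound
    allows the same replacement in [V], and comparing along [K_t] run in the
    true system gives [(1 - 2 kappa) P <= (1 - kappa) V].  Both together yield,
    for [z = (x, K_t x)],
    [(1 - 2 kappa) (|z|^2 + |M z|_P^2) <= |x|_P^2]
    ([certainty_equivalence]).

    Finally [|M z + v|_P^2] is split by Young's inequality with the weight that
    puts exactly [gamma^2] in front of [|v|^2].  This gives the dissipation
    inequality
    [|x_(t+1)|_P^2 + alpha |z_t|^2 <= |x_t|_P^2 + gamma^2 |v_t|^2]
    with [v_t = B eps_t + w_t] ([dissipation]), and summing over [t]
    telescopes. *)

(** * Quadratic forms and norms *)

Section Forms.
Set Implicit Arguments.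
Unset Strict Implicit.
Unset Printing Implicit Defensive.
Context {R : realType}.

Lemma enorm_sqr k (v : 'cV[R]_k) : enorm v ^+ 2 = \sum_i v i 0 ^+ 2.
Proof.
have vE : (v^T *m v) 0 0 = \sum_i v i 0 ^+ 2.
  by rewrite mxE; apply: eq_bigr => i _; rewrite mxE expr2.
by rewrite sqr_sqrtr vE // sumr_ge0 // => i _; rewrite sqr_ge0.
Qed.

Lemma enorm_ge0 k (v : 'cV[R]_k) : 0 <= enorm v.
Proof. exact: sqrtr_ge0. Qed.

Lemma enorm_sqrZ k a (v : 'cV[R]_k) :
  enorm (a *: v) ^+ 2 = a ^+ 2 * enorm v ^+ 2.
Proof.
by rewrite !enorm_sqr mulr_sumr; apply: eq_bigr => i _; rewrite mxE exprMn.
Qed.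

Lemma enormZ k a (v : 'cV[R]_k) : 0 <= a -> enorm (a *: v) = a * enorm v.
Proof.
move=> a0; apply/eqP; rewrite -(@eqrXn2 _ 2) ?enorm_ge0 ?mulr_ge0 ?enorm_ge0 //.
by rewrite enorm_sqrZ exprMn.
Qed.

Lemma enorm0 k : enorm (0 : 'cV[R]_k) = 0.
Proof. by rewrite -(scale0r 0) enormZ // mul0r. Qed.

Lemma enorm_sqr_col_mx k l (v : 'cV[R]_k) (w : 'cV[R]_l) :
  enorm (col_mx v w) ^+ 2 = enorm v ^+ 2 + enorm w ^+ 2.
Proof.
rewrite !enorm_sqr big_split_ord /=.
by congr (_ + _); apply: eq_bigr => i _; rewrite ?col_mxEu ?col_mxEd.
Qed.

Lemma enorm_eq0 k (v : 'cV[R]_k) : enorm v = 0 -> v = 0.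
Proof.
move=> v0; have /eqP := enorm_sqr v; rewrite v0 expr0n /= eq_sym.
rewrite psumr_eq0 => [/allP vi0|i _]; last exact: sqr_ge0.
apply/matrixP => i j; rewrite ord1 mxE; apply/eqP; rewrite -sqrf_eq0.
by apply: vi0; rewrite mem_index_enum.
Qed.

Lemma qformD k (X Y : 'M[R]_k) v : qform (X + Y) v = qform X v + qform Y v.
Proof. by rewrite /qform mulmxDr mulmxDl mxE. Qed.

Lemma qformN k (X : 'M[R]_k) v : qform (- X) v = - qform X v.
Proof. by rewrite /qform mulmxN mulNmx mxE. Qed.

Lemma qformZ k a (X : 'M[R]_k) v : qform (a *: X) v = a * qform X v.
Proof. by rewrite /qform -scalemxAr -scalemxAl mxE. Qed.

Lemma qform_scalar k a (v : 'cV[R]_k) : qform a%:M v = a * enorm v ^+ 2.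
Proof.
rewrite -scalemx1 qformZ /qform mulmx1 enorm_sqr mxE; congr (_ * _).
by apply: eq_bigr => i _; rewrite mxE expr2.
Qed.

Lemma qform_congr k l (M : 'M[R]_(k, l)) (X : 'M[R]_k) v :
  qform (M^T *m X *m M) v = qform X (M *m v).
Proof. by rewrite /qform trmx_mul !mulmxA. Qed.

Lemma qform_tr_mul k l (M : 'M[R]_(k, l)) v :
  qform (M^T *m M) v = enorm (M *m v) ^+ 2.
Proof. by rewrite -[M^T]mulmx1 qform_congr qform_scalar mul1r. Qed.

Lemma lemx_qform k (X Y : 'M[R]_k) v : lemx X Y -> qform X v <= qform Y v.
Proof. by case=> _ /(_ v); rewrite qformD qformN subr_ge0. Qed.

(** The crude sum of the entries suffices: [p] only serves to show that a
    supremum is finite and that a strictly decreasing budget runs out, and it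
    enters no estimate. *)
Lemma qform_bounded k (X : 'M[R]_k) :
  exists2 p : R, 0 <= p & forall v, qform X v <= p * enorm v ^+ 2.
Proof.
exists (\sum_j \sum_i `|X i j|).
  by apply: sumr_ge0 => j _; apply: sumr_ge0.
move=> v; have vi i : `|v i 0| <= enorm v.
  rewrite -(@ler_pXn2r _ 2) ?nnegrE ?enorm_ge0 // enorm_sqr.
  rewrite real_normK ?num_real //.
  by rewrite (bigD1 i) //= lerDl sumr_ge0 // => j _; rewrite sqr_ge0.
rewrite /qform mxE mulr_suml ler_sum // => j _.
rewrite mxE !mulr_suml ler_sum // => i _.
rewrite (le_trans (ler_norm _)) // mxE !normrM mulrAC mulrC expr2.
by rewrite ler_wpM2l // ler_pM.
Qed.

(** Both bounds on the cross term come from nonnegativity of the form at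
    [s v + w] and at [s v - w]. *)
Lemma qform_young k (X : 'M[R]_k) (s : R) (v w : 'cV[R]_k) :
  (forall z, 0 <= qform X z) -> 0 < s ->
  `|qform X (v + w) - qform X v - qform X w|
    <= s * qform X v + s^-1 * qform X w.
Proof.
move=> X0 s0.
pose c : R := (v^T *m X *m w + w^T *m X *m v) 0 0.
have qE a b : qform X (a *: v + b *: w)
    = a ^+ 2 * qform X v + b ^+ 2 * qform X w + a * b * c.
  have tE : (a *: v + b *: w)^T = a *: v^T + b *: w^T.
    by apply/matrixP => i j; rewrite !mxE.
  rewrite /c /qform tE.
  rewrite !mulmxDl !mulmxDr -!(scalemxAl, scalemxAr) !mxE; ring.
have -> : qform X (v + w) - qform X v - qform X w = c.
  by have := qE 1 1; rewrite !scale1r => ->; ring.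
have := X0 (s *: v + 1 *: w); have := X0 (s *: v + (-1) *: w).
rewrite !qE => h1 h2.
rewrite -(ler_pM2l s0) mulrDr mulVKf ?gt_eqF // -{1}(gtr0_norm s0) -normrM.
by rewrite ler_norml; apply/andP; split; lra.
Qed.

(** A supremum bounds its set only when that set is bounded above, which is
    where the crude entrywise bound [qform_bounded] enters. *)
Lemma spnormP k l (M : 'M[R]_(k, l)) v : enorm (M *m v) <= spnorm M * enorm v.
Proof.
have [p p0 Mp] := qform_bounded (M^T *m M).
have ubM : ubound [set enorm (M *m v) | v in [set v | enorm v <= 1]] (p + 1).
  move=> _ [z /= z1 <-]; have := Mp z; rewrite qform_tr_mul.
  have z2 : enorm z ^+ 2 <= 1 by rewrite expr_le1 ?enorm_ge0.
  have := ler_wpM2l p0 z2; have := sqr_ge0 (enorm (M *m z) - 1).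
  by have := enorm_ge0 (M *m z); lra.
have [/enorm_eq0 ->|v0] := eqVneq (enorm v) 0.
  by rewrite mulmx0 !enorm0 mulr0.
have vgt0 : 0 < enorm v by rewrite lt_def v0 enorm_ge0.
rewrite -ler_pdivrMr // mulrC -enormZ ?invr_ge0 ?enorm_ge0 // scalemxAr.
apply: ub_le_sup; first by exists (p + 1).
exists ((enorm v)^-1 *: v) => //=.
by rewrite enormZ ?invr_ge0 ?enorm_ge0 // mulVf.
Qed.

Lemma pdmx_qform_ge0 k (X : 'M[R]_k) : pdmx X -> forall v, 0 <= qform X v.
Proof.
case=> _ X0 v; have [->|v0] := eqVneq v 0; last exact/ltW/X0.
by rewrite /qform mulmx0 mxE.
Qed.

Lemma pdmx_unit k (X : 'M[R]_k) : pdmx X -> X \in unitmx.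
Proof.
case=> _ X0; rewrite unitmxE unitfE; apply/negP => /det0P [v v0 vX].
have := X0 v^T; rewrite /qform trmxK vX mul0mx mxE ltxx trmx_eq0 => H.
by have := H v0.
Qed.

Lemma pdmx_Sigma_ n m lambda (x : nat -> 'cV[R]_n) (u : nat -> 'cV[R]_m)
    Sigma0 t :
  0 < lambda -> pdmx Sigma0 -> pdmx (Sigma_ lambda x u Sigma0 t).
Proof.
move=> l0 [S0T S0]; split=> [|v v0].
  rewrite /Sigma_ linearD linearZ /= S0T linear_sum /=; congr (_ + _).
  by apply: eq_bigr => k _; rewrite linearZ /= trmx_mul trmxK.
rewrite /Sigma_ qformD qformZ ltr_wpDl ?mulr_gt0 ?exprn_gt0 ?S0 //.
elim/big_ind: _ => [|X Y X0 Y0|k _].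
- by rewrite /qform mulmx0 mul0mx mxE.
- by rewrite qformD addr_ge0.
rewrite qformZ mulr_ge0 ?exprn_ge0 ?(ltW l0) //.
by rewrite -{1}[col_mx _ _]trmxK qform_tr_mul sqr_ge0.
Qed.

End Forms.

(** * Value functions and their comparison *)

Section Riccati.
Set Implicit Arguments.
Unset Strict Implicit.
Unset Printing Implicit Defensive.
Context {R : realType} {n m : nat}.
Implicit Types (M N : 'M[R]_(n, n + m)) (V W P : 'M[R]_n) (K : 'M[R]_(m, n)).
Implicit Types (x y : 'cV[R]_n) (z : 'cV[R]_(n + m)).

Definition feedback K x : 'cV[R]_(n + m) := col_mx x (K *m x).

(** The cost of one step from the state-input pair [z = (x, u)] under the
    dynamics [x' = M z], when [V] prices the next state: the right-hand side of
    the Bellman equation before minimization. *)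
Definition onestep M V z : R := enorm z ^+ 2 + qform V (M *m z).

(** The Bellman equation for the dynamics [M], with minimizing gain [K], stated
    for the values of the forms.  This is the common shape of the model-based
    and of the data-driven Riccati equation. *)
Definition optimal_value M V K : Prop :=
  (forall x, qform V x = onestep M V (feedback K x)) /\
  (forall K' x, qform V x <= onestep M V (feedback K' x)).

Lemma le_enorm_feedback K x : enorm x ^+ 2 <= enorm (feedback K x) ^+ 2.
Proof. by rewrite enorm_sqr_col_mx lerDl sqr_ge0. Qed.

Lemma qform_gainform (Q : 'M[R]_(n + m)) K x :
  qform (gainform Q K) x = qform Q (feedback K x).
Proof. by rewrite qform_congr mul_col_mx mul1mx. Qed.

Lemma qform_riccatiform A B P K x :
  qform (riccatiform A B P K) x = onestep (row_mx A B) P (feedback K x).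
Proof.
rewrite /riccatiform 2!qformD qform_scalar mul1r qform_tr_mul qform_congr.
by rewrite /onestep enorm_sqr_col_mx mul_row_col mulmxDl mulmxA.
Qed.

Lemma optimal_value_riccatiform A B P :
  is_minmx (riccatiform A B P) P -> exists K, optimal_value (row_mx A B) P K.
Proof.
case=> K minK PE; exists K; split=> [x|K' x].
  by rewrite {1}PE qform_riccatiform.
by rewrite {1}PE -qform_riccatiform; exact: lemx_qform.
Qed.

Lemma qform_riccati (Q : 'M[R]_(n + m)) M V z :
  Q - 1%:M = M^T *m V *m M -> qform Q z = onestep M V z.
Proof.
move=> QE; rewrite -[Q](subrK 1%:M) qformD QE qform_congr qform_scalar mul1r.
exact: addrC.
Qed.

(** Multiplying the equation by [Sigma^-1] on both sides moves the data into
    the least-squares model [hSigma Sigma^-1]. *)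
Lemma data_riccati_model (Sigma : 'M[R]_(n + m)) hSigma (Q : 'M[R]_(n + m)) :
  pdmx Sigma -> data_riccati Sigma hSigma Q ->
  let N := hSigma *m invmx Sigma in
  exists2 V, is_minmx (gainform Q) V & Q - 1%:M = N^T *m V *m N.
Proof.
move=> SigmaP [V minV VE] /=; exists V => //; case: (SigmaP) => SigmaT _.
have SigmaU := pdmx_unit SigmaP.
rewrite trmx_mul trmx_inv SigmaT.
rewrite -!mulmxA (mulmxA V) (mulmxA _ (V *m _)) mulmxA (mulmxA (invmx _)).
rewrite -(mulmxA (invmx _)) (mulmxA _ V) -VE.
by rewrite !mulmxA mulVmx // mul1mx mulmxK.
Qed.

Lemma gainform_min_ge0 (Q : 'M[R]_(n + m)) V :
  is_minmx (gainform Q) V -> (forall z, 0 <= qform Q z) ->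
  forall x, 0 <= qform V x.
Proof. by case=> K _ -> Q0 x; rewrite qform_gainform. Qed.

Lemma optimal_value_gainform (Q : 'M[R]_(n + m)) M V K :
  is_minmx (gainform Q) V -> is_argminmx (gainform Q) K ->
  (forall z, qform Q z = onestep M V z) -> optimal_value M V K.
Proof.
case=> K0 minK0 -> minK QE; split=> [x|K' x].
  rewrite -QE -qform_gainform; apply: le_anti.
  by rewrite !lemx_qform.
by rewrite -QE -qform_gainform; exact: lemx_qform.
Qed.

(** Along the trajectory [x_k] of the policy [K], [c V - W] does not decrease.
    If it were [d > 0] at the start, then [d <= c V(x_k) <= c p |x_k|^2] for
    all [k], where [p] bounds [V], while a step takes at least [c |x_k|^2] away
    from [W].  So [p W] would drop by [d] at every step, although it is
    nonnegative.  No separate stability argument for the closed loop is called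
    for. *)
Lemma riccati_comparison M K V W (c : R) :
  0 < c ->
  (forall x, 0 <= qform W x) ->
  (forall x, c * enorm (feedback K x) ^+ 2 + qform W (M *m feedback K x)
             <= qform W x) ->
  (forall x, qform V x <= onestep M V (feedback K x)) ->
  forall x, c * qform V x <= qform W x.
Proof.
move=> c0 W0 Wsup Vsub x; rewrite leNgt; apply/negP => ltWV.
pose d := c * qform V x - qform W x.
have d0 : 0 < d by rewrite subr_gt0.
have [p p0 Vp] := qform_bounded V.
pose xs k := iter k (fun y => M *m feedback K y) x.
have gap k : d <= c * qform V (xs k) - qform W (xs k).
  elim: k => // k IH /=; have := Wsup (xs k).
  by have := Vsub (xs k); rewrite /onestep -(ler_pM2l c0) mulrDr; lra.
have decr k : p * qform W (xs k) <= p * qform W x - k%:R * d.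
  elim: k => [|k IH]; first by rewrite mul0r subr0.
  have := Wsup (xs k); rewrite -[M *m _]/(xs k.+1) => /(ler_wpM2l p0).
  have := le_enorm_feedback K (xs k) => /(ler_wpM2l (mulr_ge0 p0 (ltW c0))).
  have := Vp (xs k) => /(ler_wpM2l (ltW c0)) h1 h2 h3.
  by have := gap k; have := W0 (xs k); rewrite -natr1; lra.
have pW0 : 0 <= p * qform W x / d by rewrite divr_ge0 ?mulr_ge0 // ltW.
have := archi_boundP pW0; set k := Num.bound _.
rewrite ltr_pdivrMr // => ltk.
by have := decr k; have := mulr_ge0 p0 (W0 (xs k)); lra.
Qed.

(** Each value function is a supersolution along its own policy and a
    subsolution along every policy, so the two dominate each other. *)
Lemma optimal_value_unique M V V' K K' :
  (forall x, 0 <= qform V x) -> (forall x, 0 <= qform V' x) ->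
  optimal_value M V K -> optimal_value M V' K' -> qform V =1 qform V'.
Proof.
have le V1 V2 K1 K2 : (forall x, 0 <= qform V2 x) -> optimal_value M V1 K1 ->
    optimal_value M V2 K2 -> forall x, qform V1 x <= qform V2 x.
  move=> V20 [_ V1min] [V2E _] x; rewrite -[leLHS]mul1r.
  by apply: (@riccati_comparison M K2) => // y; rewrite mul1r [leRHS]V2E.
move=> V0 V0' optV optV' x; apply: le_anti.
by rewrite (le _ _ K K') ?(le _ _ K' K).
Qed.

(** Compare with the zero input, for which [z = (x, 0)] has the norm of [x]. *)
Lemma optimal_value_bounded M V K b :
  optimal_value M V K -> (forall z, onestep M V z <= b * enorm z ^+ 2) ->
  forall x, qform V x <= b * enorm x ^+ 2.
Proof.
move=> [_ Vmin] Mb x; rewrite (le_trans (Vmin 0 x)) // (le_trans (Mb _)) //.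
by rewrite enorm_sqr_col_mx mul0mx enorm0 expr0n addr0.
Qed.

(** How much is lost when the gain [K], optimal for the model [N], is used in
    the true system [M].  The bounds [VP] and [PV] are the two comparisons: [K0]
    run in the model and [K] run in the true system.  The second perturbation is
    measured in [V], for which [VP] supplies the only upper bound, so [VP] comes
    first. *)
Lemma certainty_equivalence M N P V K0 K (beta rho : R) :
  let kappa := beta ^+ 2 * rho * (rho + 2) in
  0 < rho -> 0 < 1 - 2 * kappa ->
  (forall x, 0 <= qform P x) -> (forall x, 0 <= qform V x) ->
  optimal_value M P K0 -> optimal_value N V K ->
  (forall z, onestep M P z <= beta ^+ 2 * enorm z ^+ 2) ->
  (forall z, enorm ((M - N) *m z) <= rho * enorm z) ->
  forall x, (1 - 2 * kappa) * onestep M P (feedback K x) <= qform P x.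
Proof.
move=> kappa rho0 d0 P0 V0 optP optV Pb MN.
have [[PE Pmin] [VE Vmin]] := (optP, optV).
have b0 : 0 <= beta ^+ 2 by exact: sqr_ge0.
have k0 : 0 <= kappa by rewrite mulr_ge0 ?addr_ge0 ?(mulr_ge0 b0) // ltW.
have k1 : 0 < 1 - kappa by lra.
have NE z : N *m z = M *m z + (N - M) *m z by rewrite -mulmxDl addrC subrK.
have PMz z : qform P (M *m z) <= beta ^+ 2 * enorm z ^+ 2.
  by have := Pb z; rewrite /onestep; have := sqr_ge0 (enorm z); lra.
have PDz z : qform P ((N - M) *m z) <= beta ^+ 2 * rho ^+ 2 * enorm z ^+ 2.
  rewrite (le_trans (optimal_value_bounded optP Pb _)) // -mulrA ler_wpM2l //.
  rewrite -exprMn -opprB mulNmx -scaleN1r enorm_sqrZ sqrrN expr1n mul1r.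
  by rewrite lerXn2r ?nnegrE ?enorm_ge0 // mulr_ge0 ?enorm_ge0 ?ltW.
(* Young's inequality is used with weight [rho], which balances
   [|M z|_P <= beta |z|] against [|(N - M) z|_P <= beta rho |z|]. *)
have cross z : rho * qform P (M *m z) + rho^-1 * qform P ((N - M) *m z)
    <= 2 * beta ^+ 2 * rho * enorm z ^+ 2.
  have := PMz z; rewrite -(ler_pM2l rho0) => h1.
  have := PDz z; rewrite -(ler_pM2l (_ : 0 < rho^-1)) ?invr_gt0 // => h2.
  rewrite (le_trans (lerD h1 h2)) // le_eqVlt; apply/orP; left; apply/eqP.
  by field; rewrite gt_eqF.
have kE z : kappa * enorm z ^+ 2 = 2 * beta ^+ 2 * rho * enorm z ^+ 2
    + beta ^+ 2 * rho ^+ 2 * enorm z ^+ 2 by rewrite /kappa; ring.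
have VP x : (1 - kappa) * qform V x <= qform P x.
  apply: (@riccati_comparison N K0) => // y; rewrite [leRHS]PE /onestep.
  set z := feedback _ _; rewrite NE.
  have /ler_normlP[_] := qform_young (M *m z) ((N - M) *m z) P0 rho0.
  by have := cross z; have := PDz z; have := kE z; lra.
have Vstep x : (1 - 2 * kappa) * enorm (feedback K x) ^+ 2
    + (1 - kappa) * qform V (M *m feedback K x) <= (1 - kappa) * qform V x.
  rewrite (VE x) /onestep; set z := feedback _ _; rewrite NE.
  have /ler_normlP[+ _] := qform_young (M *m z) ((N - M) *m z) V0 rho0.
  rewrite -(ler_pM2l k1) => hY.
  have h1 := VP (M *m z); have h2 := VP ((N - M) *m z).
  have := cross z; have := kE z.
  have := ler_wpM2l (ltW rho0) h1.
  have := ler_wpM2l (_ : 0 <= rho^-1) h2; rewrite invr_ge0 ltW // => /(_ isT).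
  have := mulr_ge0 (ltW k1) (V0 ((N - M) *m z)).
  have := mulr_ge0 (mulr_ge0 b0 (sqr_ge0 rho)) (sqr_ge0 (enorm z)).
  by lra.
have PV x : (1 - 2 * kappa) * qform P x <= (1 - kappa) * qform V x.
  rewrite -[leRHS]qformZ; apply: (@riccati_comparison M K) => // y.
    by rewrite qformZ mulr_ge0 // ltW.
  by rewrite !qformZ.
move=> x; have := Vstep x; have := VP x; have := PV (M *m feedback K x).
by rewrite /onestep; lra.
Qed.

(** After Young's inequality the factor [1 + s = 1 / (1 - beta^2 / gamma^2)]
    multiplies [onestep M P z - beta^2 / delta |z|^2], with [z] the pair
    [(x, K x)].  This difference is nonpositive ([nonpos]), so the factor can be
    dropped.  What is left ([dP]) holds because the cost exceeds [|x|_P^2] by at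
    most [(1 / delta - 1) |x|_P^2], and [|x|_P^2 <= beta^2 |z|^2]. *)
Lemma dissipation M P K (beta gamma delta : R) x v :
  0 < gamma -> 0 < beta ->
  0 < 1 - beta ^+ 2 / gamma ^+ 2 -> 0 < delta <= 1 ->
  (forall y, 0 <= qform P y) ->
  (forall y, qform P y <= beta ^+ 2 * enorm y ^+ 2) ->
  (forall z, onestep M P z <= beta ^+ 2 * enorm z ^+ 2) ->
  delta * onestep M P (feedback K x) <= qform P x ->
  qform P (M *m feedback K x + v)
    + (beta ^+ 2 + 1 / (1 - beta ^+ 2 / gamma ^+ 2) * (1 - beta ^+ 2 / delta))
        * enorm (feedback K x) ^+ 2
    <= qform P x + gamma ^+ 2 * enorm v ^+ 2.
Proof.
move=> g0 b0 hg /andP[d0 d1] P0 Pb Mb Px.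
set z := feedback K x in Px *.
(* The weight for which Young's inequality turns [|v|_P^2 <= beta^2 |v|^2]
   into exactly [gamma^2 |v|^2]; see [vE]. *)
pose s := beta ^+ 2 / gamma ^+ 2 / (1 - beta ^+ 2 / gamma ^+ 2).
have s0 : 0 < s by rewrite !divr_gt0 ?exprn_gt0.
have gb0 : 0 < gamma ^+ 2 - beta ^+ 2.
  by move: hg; rewrite !subr_gt0 ltr_pdivrMr ?exprn_gt0 // mul1r.
have gE : 1 / (1 - beta ^+ 2 / gamma ^+ 2) = 1 + s.
  by rewrite /s; field; rewrite !gt_eqF.
have vE : (1 + s^-1) * beta ^+ 2 = gamma ^+ 2.
  by rewrite /s; field; rewrite !gt_eqF.
rewrite gE.
have /ler_normlP[_] := qform_young (M *m z) v P0 s0.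
have s1 : 0 <= 1 + s^-1 by rewrite addr_ge0 // invr_ge0 ltW.
have := ler_wpM2l s1 (Pb v); rewrite mulrA vE => hv.
have dV1 : 1 <= delta^-1 by rewrite invf_ge1.
have xz : qform P x <= beta ^+ 2 * enorm z ^+ 2.
  by rewrite (le_trans (Pb x)) // ler_wpM2l ?sqr_ge0 ?le_enorm_feedback.
have dP : onestep M P z
    <= qform P x + (delta^-1 - 1) * (beta ^+ 2 * enorm z ^+ 2).
  have : onestep M P z <= delta^-1 * qform P x by rewrite ler_pdivlMl.
  have : 0 <= delta^-1 - 1 by rewrite subr_ge0.
  by move=> /ler_wpM2l /(_ _ _ xz); lra.
have nonpos : s * (onestep M P z - delta^-1 * (beta ^+ 2 * enorm z ^+ 2)) <= 0.
  rewrite pmulr_rle0 // subr_le0 (le_trans (Mb z)) // ler_peMl //.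
  by rewrite mulr_ge0 ?sqr_ge0.
by rewrite /onestep in dP nonpos *; lra.
Qed.

End Riccati.

(** * The closed-loop bound *)

Theorem corollary2 (R : realType) (n m : nat)
  (beta rho gamma lambda : R)
  (hbeta : 1 < beta) (hrho : 0 < rho) (hgamma : 0 < gamma)
  (hlambda : 0 < lambda < 1)
  (* both denominators in alpha are positive; the claim can fail otherwise *)
  (hden_gamma : 0 < 1 - beta ^+ 2 / gamma ^+ 2)
  (hden_rho : 0 < 1 - 2 * beta ^+ 2 * rho * (rho + 2))
  (A : 'M[R]_n) (B : 'M[R]_(n, m)) (hAB : calM beta (A, B))
  (P : 'M[R]_n) (hPpos : pdmx P) (hP : is_minmx (riccatiform A B P) P)
  (x w : nat -> 'cV[R]_n) (u eps : nat -> 'cV[R]_m) (K : nat -> 'M[R]_(m, n))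
  (hx : forall t : nat, x t.+1 = A *m x t + B *m u t + w t)
  (hu : forall t : nat, u t = K t *m x t + eps t)
  (Sigma0 : 'M[R]_(n + m)) (hSigma0 : pdmx Sigma0)
  (t0 : nat)
  (hest : forall t : nat, (t0 <= t)%N ->
     spnorm (row_mx A B
             - hSigma_ lambda x u t *m invmx (Sigma_ lambda x u Sigma0 t))
       <= rho)
  (Q : nat -> 'M[R]_(n + m))
  (* the setting in which the minimum over the gain is the Schur complement;
     the equation can also have indefinite solutions *)
  (hQpos : forall t : nat, pdmx (Q t))
  (hQ : forall t : nat,
     data_riccati (Sigma_ lambda x u Sigma0 t) (hSigma_ lambda x u t) (Q t))
  (hK : forall t : nat, is_argminmx (gainform (Q t)) (K t))
  (halpha : 0 < alpha_ beta rho gamma)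
  (T : nat) (hT : (t0 < T)%N) :
  \sum_(t0 <= t < T) (enorm (x t) ^+ 2 + enorm (K t *m x t) ^+ 2)
    <= (alpha_ beta rho gamma)^-1 * qform P (x t0)
       + gamma ^+ 2 / alpha_ beta rho gamma
         * \sum_(t0 <= t < T) enorm (B *m eps t + w t) ^+ 2.
Proof.
have b0 : 0 < beta by rewrite (lt_trans ltr01).
have l0 : 0 < lambda by case/andP: hlambda.
pose M := row_mx A B.
have P0 := pdmx_qform_ge0 hPpos.
have [K0 optP] := optimal_value_riccatiform hP.
(* [calM] speaks of some solution [S]; its one-step cost is the form of [Qs],
   and uniqueness transfers the bound on [Qs] to [P]. *)
have Mb z : onestep M P z <= beta ^+ 2 * enorm z ^+ 2.
  have [Qs [S [minS /qform_riccati QE Q1 Qb]]] := hAB.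
  have [Ks minKs _] := minS.
  have S0 : forall y, 0 <= qform S y.
    apply: gainform_min_ge0 minS _ => y.
    by rewrite (le_trans _ (lemx_qform y Q1)) // qform_scalar mul1r sqr_ge0.
  have optS := optimal_value_gainform minS minKs QE.
  rewrite /onestep (optimal_value_unique P0 S0 optP optS) -/(onestep M S z).
  by rewrite -QE -qform_scalar lemx_qform.
have kE : 2 * beta ^+ 2 * rho * (rho + 2) = 2 * (beta ^+ 2 * rho * (rho + 2)).
  by rewrite !mulrA.
pose delta := 1 - 2 * beta ^+ 2 * rho * (rho + 2).
have d1 : 0 < delta <= 1.
  rewrite hden_rho gerBl.
  by rewrite !mulr_ge0 ?addr_ge0 ?sqr_ge0 // ltW.
have step t : (t0 <= t)%N ->
    alpha_ beta rho gamma * (enorm (x t) ^+ 2 + enorm (K t *m x t) ^+ 2)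
    <= qform P (x t) - qform P (x t.+1)
       + gamma ^+ 2 * enorm (B *m eps t + w t) ^+ 2.
  move=> t0t.
  have SigmaP := pdmx_Sigma_ x u t l0 hSigma0.
  have [V minV /qform_riccati QE] := data_riccati_model SigmaP (hQ t).
  have V0 : forall y, 0 <= qform V y.
    exact: gainform_min_ge0 minV (pdmx_qform_ge0 (hQpos t)).
  have optV := optimal_value_gainform minV (hK t) QE.
  have MN z : enorm ((M - hSigma_ lambda x u t
      *m invmx (Sigma_ lambda x u Sigma0 t)) *m z) <= rho * enorm z.
    by rewrite (le_trans (spnormP _ _)) // ler_wpM2r ?enorm_ge0 ?hest.
  have hd : 0 < 1 - 2 * (beta ^+ 2 * rho * (rho + 2)) by rewrite -kE.
  have := certainty_equivalence hrho hd P0 V0 optP optV Mb MN (x t).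
  rewrite -kE => hdelta.
  have Pb := optimal_value_bounded optP Mb.
  have := dissipation (B *m eps t + w t) hgamma b0 hden_gamma d1 P0 Pb Mb
    hdelta.
  have -> : M *m feedback (K t) (x t) + (B *m eps t + w t) = x t.+1.
    by rewrite mul_row_col hx hu mulmxDr !addrA.
  by rewrite enorm_sqr_col_mx -/(alpha_ beta rho gamma); lra.
rewrite (mulrC (gamma ^+ 2)) -mulrA -mulrDr ler_pdivlMl // !mulr_sumr.
have le_step t : (t0 <= t < T)%N -> _ := fun tT => step t (proj1 (andP tT)).
rewrite (le_trans (ler_sum_nat le_step)) //.
rewrite big_split /= lerD2r.
rewrite (telescope_sumr_eq (fun t => - qform P (x t))) 1?ltnW //.
  by rewrite opprK addrC gerBl P0.
by move=> t _; rewrite opprK addrC.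
Qed.
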